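(* Let $G=(V,E)$ be an unweighted graph on $n$ vertices with no vertex of degree $1$. Given access to a $(1/6,2n)$-friendly cut sparsifier $H_{\mathrm{fr}}=(V_{H_{\mathrm{fr}}},E_{H_{\mathrm{fr}}})$ of $G$ (with each edge recorded with its original endpoints in $G$) and the vertex degrees of $G$, one can construct an APMC sparsifier $H_{\mathrm{ap}}=(U,E_{\mathrm{ap}})$ of $G$ with $|E_{\mathrm{ap}}|\le |E_{H_{\mathrm{fr}}}|+n$ in time $O(|E_{H_{\mathrm{fr}}}|+n)$.
   Context: Graphs are undirected, unweighted and simple. For a weighted graph $H$ and vertex set $S$, $\mathrm{cut}_H(S)$ is the total weight of edges with exactly one endpoint in $S$; $\lambda_H(s,t)=\min\{\mathrm{cut}_H(S): s\in S,\ t\notin S\}$, and a minimizer is a minimum $s,t$-cut. An APMC sparsifier of $G=(V,E)$ is a weighted graph $H=(U,E_H,w)$ with $U\supseteq V$ such that for every $s,t\in V$ there exists a minimum $s,t$-cut $S_H$ in $H$ with $S_H\cap V$ a minimum $s,t$-cut in $G$ and $\lambda_H(s,t)=\mathrm{cut}_H(S_H)=\mathrm{cut}_G(S_H\cap V)=\lambda_G(s,t)$. Friendliness: for a cut $S\subseteq V$ and $v\in V$, with $c_v(S)$ the number of edges at $v$ crossing $S$, the friendliness ratio of $v$ is $1-c_v(S)/\deg(v)$; $S$ is $\alpha$-friendly if all $v\in V$ have ratio $\ge\alpha$. A contraction of $G$ is obtained from a partition of $V$ into super-vertices by contracting each part, keeping parallel edges and discarding self-loops. An $(\alpha,w)$-friendly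 cut sparsifier of $G$ is a contraction $H$ such that every $\alpha$-friendly cut $S$ of $G$ with $\mathrm{cut}_G(S)\le w$ has no super-vertex with vertices on both sides of $S$ (equivalently $\mathrm{cut}_H(S)=\mathrm{cut}_G(S)$). *)

(* Defs.v *)
From mathcomp Require Import all_boot all_order all_algebra.

Set Implicit Arguments.
Unset Strict Implicit.
Unset Printing Implicit Defensive.

Import Order.TTheory GRing.Theory Num.Theory.

Record sgraph (V : finType) := SGraph {
  edges : {set {set V}};
  edges_card2 : forall e, e \in edges -> #|e| = 2
}.

Record wgraph (U : finType) := WGraph {
  wedges : {set {set U}};
  weight : {set U} -> nat; (* only the values on wedges are meaningful *)
  wedges_card2 : forall e, e \in wedges -> #|e| = 2
}.

Coercion unit_weights (V : finType) (G : sgraph V) : wgraph V :=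
  WGraph (fun=> 1) (@edges_card2 V G).

Definition crosses (V : finType) (S e : {set V}) : bool := #|e :&: S| == 1.

Definition cut (U : finType) (H : wgraph U) (S : {set U}) : nat :=
  \sum_(e in wedges H | crosses S e) weight H e.

Definition st_cut (U : finType) (s t : U) (S : {set U}) : bool :=
  (s \in S) && (t \notin S).

(* Meaningful for s != t, where [set s] is an s,t-cut. *)
Definition lambda (U : finType) (H : wgraph U) (s t : U) : nat :=
  cut H [arg min_(S < [set s] | st_cut s t S) cut H S].

Definition min_st_cut (U : finType) (H : wgraph U) (s t : U) (S : {set U}) :
  Prop := st_cut s t S /\ cut H S = lambda H s t.

(* The inclusion of V in U is an injection i, so that S_H :&: V is the preimage
   of S_H under i. *)
Definition apmc_sparsifier (V U : finType) (i : V -> U) (G : sgraph V)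
    (H : wgraph U) : Prop :=
  injective i /\
  forall s t : V, s != t ->
  exists S : {set U},
    [/\ min_st_cut H (i s) (i t) S,
        min_st_cut G s t (i @^-1: S),
        lambda H (i s) (i t) = cut H S,
        cut H S = cut G (i @^-1: S)
      & cut G (i @^-1: S) = lambda G s t].

Definition deg (V : finType) (G : sgraph V) (v : V) : nat :=
  #|[set e in edges G | v \in e]|.

Definition crossing_deg (V : finType) (G : sgraph V) (S : {set V}) (v : V) :
  nat := #|[set e in edges G | (v \in e) && crosses S e]|.

(* An isolated vertex has ratio 1 - 0 / 0 = 1. *)
Definition friendliness (V : finType) (G : sgraph V) (S : {set V}) (v : V) :
  rat := (1 - (crossing_deg G S v)%:R / (deg G v)%:R)%R.

Definition friendly (V : finType) (alpha : rat) (G : sgraph V) (S : {set V}) :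
  Prop := forall v : V, (alpha <= friendliness G S v)%R.

(* The contraction given by a partition P has the parts as super-vertices. Its
   edges, parallel ones included, are identified with their originals in G; the
   discarded self-loops are the edges of G inside a part. *)
Definition contraction_edges (V : finType) (G : sgraph V) (P : {set {set V}}) :
  {set {set V}} := [set e in edges G | ~~ [exists B in P, e \subset B]].

Definition friendly_cut_sparsifier (V : finType) (alpha : rat) (w : nat)
    (G : sgraph V) (P : {set {set V}}) : Prop :=
  partition P [set: V] /\
  forall S : {set V}, friendly alpha G S -> cut G S <= w ->
  forall B : {set V}, B \in P -> (B \subset S) || [disjoint B & S].

(* Word RAM: registers and memory cells hold w-bit words, and every instruction
   costs one step. Instructions name registers, destination first; in
   ILoad r r1 and IStore r1 r2 the address is held in r1. *)
Inductive instr :=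
| IConst of nat & nat
| IAdd of nat & nat & nat
| ISub of nat & nat & nat
| ILoad of nat & nat
| IStore of nat & nat
| IJlt of nat & nat & nat
| IHalt.

Definition program := seq instr.

Record state := State {
  pc : nat;
  reg : nat -> nat;
  memory : nat -> nat
}.

Definition upd (f : nat -> nat) (a v : nat) : nat -> nat :=
  fun x => if x == a then v else f x.

Definition cur_instr (prog : program) (st : state) : instr :=
  nth IHalt prog (pc st).

Definition step (w : nat) (prog : program) (st : state) : state :=
  let: State p R M := st in
  match cur_instr prog st with
  | IConst r k => State p.+1 (upd R r (k %% 2 ^ w)) M
  | IAdd r r1 r2 => State p.+1 (upd R r ((R r1 + R r2) %% 2 ^ w)) M
  | ISub r r1 r2 => State p.+1 (upd R r (R r1 - R r2)) M
  | ILoad r r1 => State p.+1 (upd R r (M (R r1))) M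
  | IStore r1 r2 => State p.+1 R (upd M (R r1) (R r2))
  | IJlt r1 r2 l => State (if R r1 < R r2 then l else p.+1) R M
  | IHalt => st
  end.

Definition halted (prog : program) (st : state) : Prop :=
  cur_instr prog st = IHalt.

(* The input is stored from address 0 on; all else is initially 0. *)
Definition init_state (x : seq nat) : state := State 0 (fun=> 0) (nth 0 x).

Definition halts_within (w : nat) (prog : program) (x : seq nat) (bound : nat)
    (st : state) : Prop :=
  exists t : nat,
    [/\ t <= bound, st = iter t (step w prog) (init_state x) & halted prog st].

(* The output is read from the address held in register 0. *)
Definition outputs (st : state) (y : seq nat) : Prop :=
  forall j, j < size y -> memory st (reg st 0 + j) = nth 0 y j.

(* es lists each edge of E exactly once, in any order and orientation. *)
Definition edge_list (V : finType) (E : {set {set V}}) (es : seq (V * V)) :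
  Prop := perm_eq [seq [set e.1; e.2] | e <- es] (enum E).

Definition supervertex_numbering (V : finType) (P : {set {set V}})
    (num : {set V} -> nat) : Prop :=
  {in P &, injective num} /\ {in P, forall B, num B < #|P|}.

(* Number of vertices of G, of super-vertices and of contracted edges; the
   super-vertex of each vertex; the degrees in G; the contracted edges by their
   original endpoints. *)
Definition input_code (n : nat) (G : sgraph 'I_n) (P : {set {set 'I_n}})
    (num : {set 'I_n} -> nat) (es : seq ('I_n * 'I_n)) : seq nat :=
  [:: n; #|P|; size es]
  ++ [seq num (pblock P v) | v <- enum 'I_n]
  ++ [seq deg G v | v <- enum 'I_n]
  ++ flatten [seq [:: nat_of_ord e.1; nat_of_ord e.2] | e <- es].

Definition wgraph_code (N : nat) (H : wgraph 'I_N) (es : seq ('I_N * 'I_N)) :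
  seq nat :=
  [:: N; size es]
  ++ flatten [seq [:: nat_of_ord e.1; nat_of_ord e.2; weight H [set e.1; e.2]]
             | e <- es].

Definition outputs_wgraph (st : state) (N : nat) (H : wgraph 'I_N) : Prop :=
  exists2 es : seq ('I_N * 'I_N),
    edge_list (wedges H) es & outputs st (wgraph_code H es).

(* Main.v *)
(** Keep every contracted edge between its original endpoints, and join each
    vertex [v] of a super-vertex [B] to a new hub of [B], with as weight the
    number of edges of [G] at [v] inside [B]. An edge inside [B] that crosses a
    cut has an endpoint separated from the hub of [B], so the cuts of [H]
    dominate those of [G].

    Conversely, a minimum s,t-cut [T] of [G] is at most half crossing at every
    vertex but [s] and [t]. Moving those of [s] and [t] that are unfriendly to
    the other side yields a cut [F]; as [G] is simple, every other vertex gains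
    at most one crossing edge, so only vertices of degree 2 can become
    unfriendly, and they do not if [T] maximizes the excess of [s] and [t] among
    the minimum cuts. So [F] splits no super-vertex, and placing each hub on its
    side of [F] extends [T] to a cut of [H] of the same value. *)

Require Import Defs.
From mathcomp Require Import all_boot all_order all_algebra.
From mathcomp Require Import zify lra.

Set Implicit Arguments.
Unset Strict Implicit.
Unset Printing Implicit Defensive.

Import Order.TTheory GRing.Theory Num.Theory.

(** * Crossing edges and symmetric differences *)

Definition symd (V : finType) (T D : {set V}) : {set V} :=
  [set v | (v \in T) (+) (v \in D)].

Section Crossing.
Variable V : finType.
Implicit Types (S T D e : {set V}) (u v : V).

Lemma card_pairI u v S : u != v ->
  #|[set u; v] :&: S| = (u \in S) + (v \in S).
Proof.
move=> uv; rewrite (cardsD1 u) (cardsD1 v) !inE !eqxx /= orbT.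
have -> : ([set u; v] :&: S) :\ u :\ v = set0.
  by apply/setP=> w; rewrite !inE; case: (w == u); case: (w == v).
by rewrite [v == u]eq_sym uv cards0 addn0.
Qed.

Lemma crosses_pair S u v :
  u != v -> crosses S [set u; v] = (u \in S) (+) (v \in S).
Proof.
by move=> uv; rewrite /crosses card_pairI //; do 2!case: (_ \in _).
Qed.

Lemma crosses_symd T D e :
  #|e| = 2 -> crosses (symd T D) e = crosses T e (+) crosses D e.
Proof.
move=> /eqP/cards2P[u [v [uv ->]]]; rewrite !crosses_pair // !inE.
by do 4!case: (_ \in _).
Qed.

Lemma crosses1 v e : #|e| = 2 -> crosses [set v] e = (v \in e).
Proof.
move=> /eqP/cards2P[a [b [ab ->]]]; rewrite crosses_pair // !inE.
rewrite ![v == _]eq_sym.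
by case: (a =P v) ab => [->|_]; case: (b =P v) => [->|_]; rewrite ?eqxx.
Qed.

Lemma pair_through v e : #|e| = 2 -> v \in e ->
  exists2 u, v != u & e = [set v; u].
Proof.
move=> /eqP/cards2P[a [b [ab ->]]]; rewrite !inE => /orP[]/eqP->.
  by exists b.
by exists a; rewrite 1?eq_sym // setUC.
Qed.

End Crossing.

(** * Minimum cuts and the friendliness ratio *)

Lemma lambda_le (U : finType) (H : wgraph U) (s t : U) (S : {set U}) :
  s != t -> st_cut s t S -> lambda H s t <= cut H S.
Proof.
move=> st stS; rewrite /lambda; case: arg_minnP => [|S0 _]; last exact.
by rewrite /st_cut !inE eqxx eq_sym.
Qed.

Lemma min_st_cut_exists (U : finType) (H : wgraph U) (s t : U) :
  s != t -> exists S, min_st_cut H s t S.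
Proof.
move=> st; rewrite /min_st_cut /lambda; case: arg_minnP => [|S0 S0st _].
  by rewrite /st_cut !inE eqxx eq_sym.
by exists S0.
Qed.

(** Clears the denominator of the friendliness ratio. At [d = 0] the premise makes the fraction
    [0 / 0 = 0], so the ratio is 1. *)
Lemma sixth_le_ratio (R : realFieldType) (c d : nat) :
  (d = 0 -> c = 0) -> 6 * c <= 5 * d -> (1 / 6 <= 1 - c%:R / d%:R :> R)%R.
Proof.
move=> d0; case: (posnP d) => [/[dup] dE /d0 -> _|d_gt0 le].
  by rewrite mul0r subr0; lra.
have dR : (0 < d%:R :> R)%R by rewrite ltr0n.
rewrite lerBrDr -lerBrDl ler_pdivrMr //.
have : ((6 * c)%:R <= (5 * d)%:R :> R)%R by rewrite ler_nat.
by rewrite !natrM; lra.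
Qed.

(** * A friendly cut close to a minimum cut *)

Section Cuts.
Variables (V : finType) (G : sgraph V).
Implicit Types (S T D e : {set V}) (s t u v : V).

Lemma cut_sum T : cut G T = \sum_(e in edges G) crosses T e.
Proof. by rewrite /cut big_mkcondr; apply: eq_bigr => e _; case: crosses. Qed.

Lemma card_edges_sum (p : pred {set V}) :
  #|[set e in edges G | p e]| = \sum_(e in edges G) p e.
Proof.
rewrite -sum1dep_card big_mkcondr.
by apply: eq_bigr => e _; case: (p e).
Qed.

Lemma crossing_deg_le T v : crossing_deg G T v <= deg G v.
Proof.
by apply/subset_leq_card/subsetP=> e; rewrite !inE => /and3P[-> -> _].
Qed.

(** Flipping [v] exchanges the crossing and the other edges at [v]; the additive form avoids
    truncated subtraction. *)
Lemma cut_flip T v :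
  cut G (symd T [set v]) + 2 * crossing_deg G T v = cut G T + deg G v.
Proof.
rewrite !cut_sum /deg /crossing_deg !card_edges_sum big_distrr /= -!big_split.
apply: eq_bigr => e /edges_card2 e2 /=.
by rewrite crosses_symd // crosses1 //; case: crosses; case: (_ \in _).
Qed.

Lemma cut_set1 s : cut G [set s] = deg G s.
Proof.
rewrite cut_sum /deg card_edges_sum.
by apply: eq_bigr => e /edges_card2 e2; rewrite crosses1.
Qed.

Lemma deg_lt v : deg G v < #|V|.
Proof.
have sub : [set e in edges G | v \in e] \subset
    [set [set v; u] | u in [set~ v]].
  apply/subsetP=> e; rewrite inE => /andP[/edges_card2 e2 /(pair_through e2)].
  case=> u vu ->; apply/imsetP; exists u => //.
  by rewrite !inE eq_sym.
apply: leq_ltn_trans (subset_leq_card sub) _.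
apply: leq_ltn_trans (leq_imset_card _ _) _.
by rewrite cardsC1; have : 0 < #|V| by [apply/card_gt0P; exists v]; lia.
Qed.

Lemma crossing_deg_mono S T v :
  (forall u, v != u -> [set v; u] \in edges G ->
     (v \in S) (+) (u \in S) -> (v \in T) (+) (u \in T)) ->
  crossing_deg G S v <= crossing_deg G T v.
Proof.
move=> h; apply/subset_leq_card/subsetP=> e; rewrite !inE => /and3P[eG ve].
have [u vu Ee] := pair_through (edges_card2 eG) ve.
by move: eG ve; rewrite Ee !crosses_pair // => eG -> cS; rewrite eG h.
Qed.

(** Since [G] is simple, the exceptional neighbour [u0] accounts for a single edge. *)
Lemma crossing_deg_leS S T v u0 :
  (forall u, v != u -> u != u0 -> [set v; u] \in edges G ->
     (v \in S) (+) (u \in S) -> (v \in T) (+) (u \in T)) ->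
  crossing_deg G S v <= (crossing_deg G T v).+1.
Proof.
move=> h; rewrite -addn1 -(cards1 [set v; u0]).
apply: leq_trans (leq_card_setU _ _).
apply/subset_leq_card/subsetP=> e; rewrite !inE => /and3P[eG ve].
have [u vu Ee] := pair_through (edges_card2 eG) ve.
move: eG ve; rewrite Ee !crosses_pair // => eG -> cS; rewrite eG /=.
by have [->|uu0] := eqVneq u u0; rewrite ?eqxx ?orbT // h.
Qed.

Lemma crossing_deg_ltn S T v u0 :
  v != u0 -> [set v; u0] \in edges G ->
  (v \in S) = (u0 \in S) -> (v \in T) (+) (u0 \in T) ->
  (forall u, v != u -> [set v; u] \in edges G ->
     (v \in S) (+) (u \in S) -> (v \in T) (+) (u \in T)) ->
  crossing_deg G S v < crossing_deg G T v.
Proof.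
move=> vu0 e0G nS cT h; apply/proper_card/properP; split.
  apply/subsetP=> e; rewrite !inE => /and3P[eG ve].
  have [u vu Ee] := pair_through (edges_card2 eG) ve.
  by move: eG ve; rewrite Ee !crosses_pair // => eG -> cS; rewrite eG h.
exists [set v; u0]; rewrite !inE e0G eqxx /= crosses_pair ?cT //.
by rewrite nS addbb.
Qed.

Definition unfriendly T v := 5 * deg G v < 6 * crossing_deg G T v.

Definition moved s t T := [set v in [set s; t] | unfriendly T v].

(* Truncated: 0 exactly when v is friendly. *)
Definition excess T v := 6 * crossing_deg G T v - 5 * deg G v.

Lemma movedC s t T : moved s t T = moved t s T.
Proof. by rewrite /moved setUC. Qed.

Section Terminals.
Variables (s t : V) (T : {set V}).
(** Symmetric in [s] and [t], so that the lemmas below also apply with the terminals exchanged. *)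
Hypothesis sepT : (s \in T) (+) (t \in T).
Local Notation F := (symd T (moved s t T)).

Lemma in_moved_cut v :
  (v \in F) = (v \in T) (+) (((v == s) || (v == t)) && unfriendly T v).
Proof. by rewrite !inE. Qed.

(** If [s] stays, [t] can only move to the side of [s], which adds no crossing edge. If [s] moves,
    only its edge to [t] can cross both cuts, so the two crossing degrees add up to at most
    [deg G s + 1]; the one in [T] exceeds 5/6 of the degree, and a degree of at least 2 leaves
    enough room. *)
Lemma terminal_friendly : deg G s <> 1 ->
  6 * crossing_deg G F s <= 5 * deg G s.
Proof.
move=> ds1; have [us|us] := boolP (unfriendly T s); last first.
  have le : crossing_deg G F s <= crossing_deg G T s.
    apply: crossing_deg_mono => u su _.
    rewrite !in_moved_cut eqxx (negPf us) andbF addbF [u == s]eq_sym (negPf su).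
    by case: (u =P t) => [->|_] /=; rewrite ?addbF // sepT.
  by move: us; rewrite /unfriendly; lia.
suff le : crossing_deg G F s + crossing_deg G T s <= (deg G s).+1.
  by move: us; have := crossing_deg_le T s; rewrite /unfriendly; lia.
rewrite -addn1 -(cards1 [set s; t]) /crossing_deg -cardsUI.
apply: leq_add; apply/subset_leq_card/subsetP=> e; rewrite !inE.
  by move=> /orP[]/and3P[-> ->].
case/andP=> /and3P[eG se cF] /and3P[_ _ cT].
have [u su Ee] := pair_through (edges_card2 eG) se.
move: cF cT; rewrite Ee !crosses_pair // !in_moved_cut eqxx us /=.
rewrite [u == s]eq_sym (negPf su) /=.
case: (u =P t) => [->|_] /=; first by rewrite eqxx.
by case: (s \in T); case: (u \in T).
Qed.

Hypothesis minT : forall T1, (s \in T1) = (s \in T) ->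
  (t \in T1) = (t \in T) -> cut G T <= cut G T1.
Hypothesis maxT : forall T1, (s \in T1) = (s \in T) ->
  (t \in T1) = (t \in T) -> cut G T1 = cut G T ->
  excess T1 s + excess T1 t <= excess T s + excess T t.

(** Flipping [v] shows that at most half of its edges cross [T]. If [t] moves, it joins the side of
    [v], so only a move of [s] can add a crossing edge, and just one. This suffices except in degree
    2, where the maximality of the excess is needed. *)
Lemma nonterminal_friendly v : v != s -> v != t -> (v \in T) = (s \in T) ->
  deg G v <> 1 -> 6 * crossing_deg G F v <= 5 * deg G v.
Proof.
move=> vs vt vTs dv1.
have vF : (v \in F) = (v \in T).
  by rewrite in_moved_cut (negPf vs) (negPf vt) addbF.
have sT1 : (s \in symd T [set v]) = (s \in T).
  by rewrite !inE [s == v]eq_sym (negPf vs) addbF.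
have tT1 : (t \in symd T [set v]) = (t \in T).
  by rewrite !inE [t == v]eq_sym (negPf vt) addbF.
have flip := cut_flip T v.
have half : 2 * crossing_deg G T v <= deg G v.
  by move: flip (minT sT1 tT1); clear; lia.
have leS : crossing_deg G F v <= (crossing_deg G T v).+1.
  apply: (@crossing_deg_leS _ _ _ s) => u vu us _.
  rewrite vF in_moved_cut (negPf us) /= vTs.
  by case: (u =P t) => [->|_] /=; rewrite ?addbF // sepT.
have leF := crossing_deg_le F v.
have [d3|d2] := ltnP 2 (deg G v).
  by move: half leS d3; clear; lia.
have [c1|c2] := leqP (crossing_deg G F v) 1.
  by move: dv1 leF c1; clear; lia.
(* The remaining case, to be refuted: of the two edges at [v], one crosses [T] and both cross
   [F]. *)
have [dv cT] : deg G v = 2 /\ crossing_deg G T v = 1.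
  by move: half leS leF d2 c2; clear; lia.
have allF u : v != u -> [set v; u] \in edges G -> (v \in F) (+) (u \in F).
  move=> vu vuG; rewrite -crosses_pair //.
  have : [set v; u] \in [set e in edges G | (v \in e) && crosses F e].
    have /eqP-> : [set e in edges G | (v \in e) && crosses F e] ==
        [set e in edges G | v \in e].
      rewrite eqEcard; apply/andP; split.
        by apply/subsetP=> e; rewrite !inE => /and3P[-> ->].
      by change (deg G v <= crossing_deg G F v); rewrite dv.
    by rewrite !inE vuG eqxx.
  by rewrite inE => /and3P[].
(* Otherwise [s] brings [v] no new crossing edge, and the crossing degree of [v] would not have
   grown. *)
have /andP[us vsG] : unfriendly T s && ([set v; s] \in edges G).
  apply: contraT => nus.
  suff : crossing_deg G F v <= crossing_deg G T v by rewrite cT leqNgt c2.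
  apply: crossing_deg_mono => u vu vuG.
  rewrite vF in_moved_cut vTs.
  have [Eu|nu] := eqVneq u s.
    move: vuG nus; rewrite Eu => ->; rewrite andbT => /negPf->.
    by rewrite addbF.
  by case: (u =P t) => [->|_] /=; rewrite ?addbF // sepT.
(* Moving v across T keeps the cut minimum but increases the excess of s. *)
have cutT1 : cut G (symd T [set v]) = cut G T.
  by move: flip; rewrite dv cT muln1 => /addIn.
have := maxT sT1 tT1 cutT1.
have lt_s : crossing_deg G T s < crossing_deg G (symd T [set v]) s.
  apply: (@crossing_deg_ltn _ _ _ v); rewrite 1?setUC 1?eq_sym //.
    by rewrite sT1 !inE eqxx vTs addbT; case: (s \in T).
  move=> u su _; rewrite sT1 !inE.
  by case: (u =P v) => [->|_]; rewrite ?addbF // vTs addbb.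
(* The excess of [t] does not drop: it is 0 in [T] if [t] is friendly; otherwise [t] has moved to
   the side of [v], so an edge between them would not cross [F], against [allF]. *)
suff : excess T t <= excess (symd T [set v]) t.
  by move: us lt_s; rewrite /excess /unfriendly; clear; lia.
have [ut|nut] := boolP (unfriendly T t); last first.
  by rewrite [leqLHS](_ : _ = 0) //; apply/eqP; rewrite subn_eq0 leqNgt.
apply: leq_sub2r; rewrite leq_mul2l /=.
apply: crossing_deg_mono => u tu tuG; rewrite tT1 !inE.
case: (u =P v) => [Eu|_]; last by rewrite addbF.
have := allF t vt; rewrite setUC -Eu => /(_ tuG).
rewrite Eu vF vTs in_moved_cut eqxx orbT ut /= => sF _.
by move: sepT sF; case: (s \in T); case: (t \in T).
Qed.

End Terminals.

(** The terminals are flipped one after the other. Flipping an unfriendly [s] does not increase the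
    cut, as more than half of its edges cross. Unfriendliness of [t] refers to [T] and may be lost
    by then, so the second flip is bounded by [deg G t] only. *)
Lemma cut_moved_le s t T : s != t ->
  cut G (symd T (moved s t T)) <= cut G T + deg G t.
Proof.
move=> st.
have -> : symd T (moved s t T) =
    symd (symd T (moved s s T)) (if unfriendly T t then [set t] else set0).
  apply/setP=> v; rewrite !inE; case: (v =P s) => [->|_] /=.
    by case: ifP; rewrite !inE ?(negPf st) !addbF.
  rewrite addbF; case: ifP => ut; rewrite !inE;
    by case: eqP => [->|] //=; rewrite ut.
set T1 := symd T _.
have le1 : cut G T1 <= cut G T.
  have [us|us] := boolP (unfriendly T s).
    have -> : T1 = symd T [set s].
      by apply/setP=> v; rewrite !inE orbb; case: eqP => [->|] //=; rewrite us.
    by move: us (cut_flip T s); rewrite /unfriendly; lia.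
  suff -> : T1 = T by [].
  apply/setP=> v; rewrite !inE orbb.
  by case: eqP => [->|]; rewrite ?(negPf us) addbF.
case: ifP => _; first by have := cut_flip T1 t; lia.
suff -> : symd T1 set0 = T1 by lia.
by apply/setP=> v; rewrite !inE addbF.
Qed.

Lemma friendly_sixth S :
  (forall v, 6 * crossing_deg G S v <= 5 * deg G v) -> friendly (1 / 6)%R G S.
Proof.
move=> h v; apply: sixth_le_ratio; last exact: h.
by move=> dv0; apply/eqP; rewrite -leqn0 -dv0 crossing_deg_le.
Qed.

(** [F] need not separate [s] from [t]. The bound [2 * #|V|] comes from [cut G T <= deg G s], by the
    singleton cut, and an increase of at most [deg G t]. *)
Lemma min_cut_near_friendly s t : s != t -> (forall v, deg G v <> 1) ->
  exists T F, [/\ min_st_cut G s t T, friendly (1 / 6)%R G F,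
    cut G F <= 2 * #|V|
    & forall v, v != s -> v != t -> (v \in F) = (v \in T)].
Proof.
move=> st d1; have [T0 [T0st T0c]] := min_st_cut_exists G st.
case: (@arg_maxnP _ T0 (fun T => st_cut s t T && (cut G T == lambda G s t))
  (fun T => excess T s + excess T t)); first by rewrite T0st T0c /=.
move=> T /andP[Tst /eqP Tc] maxT.
have [sT tT] := andP Tst.
have sep : (s \in T) (+) (t \in T) by rewrite sT (negPf tT).
have sep' : (t \in T) (+) (s \in T) by rewrite addbC.
have st1 T1 : (s \in T1) = (s \in T) -> (t \in T1) = (t \in T) -> st_cut s t T1.
  by rewrite /st_cut => -> ->.
have minT1 T1 (h1 : (s \in T1) = (s \in T)) (h2 : (t \in T1) = (t \in T)) :
    cut G T <= cut G T1 by rewrite Tc lambda_le // st1.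
have maxT1 T1 (h1 : (s \in T1) = (s \in T)) (h2 : (t \in T1) = (t \in T)) :
    cut G T1 = cut G T -> excess T1 s + excess T1 t <= excess T s + excess T t.
  by move=> h; apply: maxT; rewrite st1 //= h Tc.
exists T, (symd T (moved s t T)); split=> //.
- apply: friendly_sixth => v.
  have [->|vs] := eqVneq v s; first exact: terminal_friendly.
  have [->|vt] := eqVneq v t; first by rewrite movedC; apply: terminal_friendly.
  have [Es|Es] := eqVneq (v \in T) (s \in T); first exact: nonterminal_friendly.
  rewrite movedC; apply: nonterminal_friendly => //.
  - by move=> T1 h1 h2; apply: minT1.
  - by move=> T1 h1 h2 h; rewrite addnC [leqRHS]addnC; apply: maxT1.
  by move: sep Es; do 3!case: (_ \in _).
- apply: leq_trans (cut_moved_le _ st) _.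
  have : cut G T <= deg G s.
    by rewrite -cut_set1 Tc lambda_le // /st_cut !inE eqxx eq_sym.
  by have := deg_lt s; have := deg_lt t; lia.
by move=> v vs vt; rewrite in_moved_cut (negPf vs) (negPf vt) addbF.
Qed.

End Cuts.

(** * The hub graph and its cuts *)

Section Star.
Variables (V U : finType) (G : sgraph V) (C : {set {set V}}).
(** [x v] stands for the hub of [v]. *)
Variables (i x : V -> U).
Hypothesis CG : C \subset edges G.
Hypothesis i_inj : injective i.
Hypothesis ix : forall u v, i u != x v.
Hypothesis inner_x : forall u v, [set u; v] \in edges G :\: C -> x u = x v.

Definition inner_deg v := #|[set e in edges G :\: C | v \in e]|.

(** Weights depend on the edge alone; the sum recovers [v] from a spoke [[set i v; x v]], where [v]
    is its only index. *)
Definition star_weight (e : {set U}) : nat :=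
  if e \in [set i @: f | f : {set V} in C] then 1
  else \sum_(v | i v \in e) inner_deg v.

Definition star_edges : {set {set U}} :=
  [set i @: f | f : {set V} in C] :|: [set [set i v; x v] | v : V].

Lemma star_card2 e : e \in star_edges -> #|e| = 2.
Proof.
case/setUP=> /imsetP[f fC ->]; last by rewrite cards2 ix.
by rewrite card_imset // (edges_card2 (subsetP CG _ fC)).
Qed.

Definition star_graph : wgraph U := WGraph star_weight star_card2.

Lemma spoke_notin v : [set i v; x v] \notin [set i @: f | f : {set V} in C].
Proof.
apply/imsetP=> -[f _ Ef]; have : x v \in i @: f by rewrite -Ef !inE eqxx orbT.
by case/imsetP=> u _ /eqP; rewrite eq_sym (negPf (ix _ _)).
Qed.

Lemma spoke_inj : injective (fun v => [set i v; x v]).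
Proof.
move=> u v /setP/(_ (i u)); rewrite !inE eqxx !(negPf (ix _ _)) !orbF.
by move=> /esym/eqP; apply: i_inj.
Qed.

Lemma star_weight_contracted f : f \in C -> star_weight (i @: f) = 1.
Proof. by move=> fC; rewrite /star_weight imset_f. Qed.

Lemma star_weight_spoke v : star_weight [set i v; x v] = inner_deg v.
Proof.
rewrite /star_weight (negPf (spoke_notin v)) (big_pred1 v) // => u.
by rewrite !inE (negPf (ix _ _)) orbF (inj_eq i_inj).
Qed.

Lemma star_edges_disjoint :
  [disjoint [set i @: f | f : {set V} in C] & [set [set i v; x v] | v : V]].
Proof.
rewrite disjoint_sym disjoint_subset; apply/subsetP=> e /imsetP[v _ ->].
exact: spoke_notin.
Qed.

Lemma card_star_edges : #|star_edges| <= #|C| + #|V|.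
Proof.
apply: leq_trans (leq_card_setU _ _) _; apply: leq_add; exact: leq_imset_card.
Qed.

(** This is the order in which the program writes the edges. *)
Lemma star_edge_list (es : seq (V * V)) : edge_list C es ->
  edge_list star_edges ([seq (i e.1, i e.2) | e <- es]
                        ++ [seq (i v, x v) | v <- enum V]).
Proof.
move=> Ces; rewrite /edge_list map_cat -2!map_comp /=.
rewrite (@eq_map _ _ _ (fun e : V * V => i @: [set e.1; e.2])); last first.
  by move=> e /=; rewrite imsetU !imset_set1.
rewrite (map_comp (fun f : {set V} => i @: f) (fun e => [set e.1; e.2])).
apply: (@perm_trans _ ([seq i @: f | f : {set V} <- enum C]
                       ++ [seq [set i v; x v] | v <- enum V])).
  by apply: perm_cat; [apply: perm_map | apply: perm_refl].
apply: uniq_perm; rewrite ?enum_uniq //.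
  rewrite cat_uniq; apply/and3P; split.
  - by rewrite map_inj_uniq ?enum_uniq //; apply: imset_inj.
  - apply/hasPn=> e /mapP[v _ ->]; apply/negP=> /mapP[f fC Ef].
    by have /imsetP[] := spoke_notin v; exists f; rewrite // -mem_enum.
  by rewrite map_inj_uniq ?enum_uniq //; apply: spoke_inj.
move=> e; rewrite mem_cat mem_enum in_setU; congr (_ || _).
  apply/mapP/imsetP=> -[f fC ->]; exists f => //.
    by rewrite -mem_enum.
  by rewrite mem_enum.
by apply/mapP/imsetP=> -[v _ ->]; exists v => //; rewrite mem_enum.
Qed.

(** The form in which the program computes the weight of a spoke. The subtraction is exact since [C]
    lies in [edges G]. *)
Lemma inner_degE v : inner_deg v = deg G v - \sum_(e in C) (v \in e).
Proof.
rewrite /deg card_edges_sum (big_setID C) /= (setIidPr CG) addKn.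
rewrite /inner_deg -sum1dep_card big_mkcondr /=.
by apply: eq_bigr => e _; case: (v \in e).
Qed.

Definition mismatch (S : {set U}) : {set V} :=
  [set v | (i v \in S) (+) (x v \in S)].

(** The crossing spokes are those at [mismatch S]; exchanging the sums over vertices and inner edges
    charges each inner edge once per mismatched endpoint. *)
Lemma cut_star S : cut star_graph S =
  \sum_(e in C) crosses (i @^-1: S) e
  + \sum_(e in edges G :\: C) #|e :&: mismatch S|.
Proof.
rewrite /cut big_mkcondr /= (big_setID [set i @: f | f : {set V} in C]) /=.
rewrite setUK setDUl setDv set0U.
rewrite (setDidPl _); last by rewrite disjoint_sym star_edges_disjoint.
congr (_ + _).
  rewrite big_imset /=; last by move=> e f _ _; apply: imset_inj.
  apply: eq_bigr => e eC; rewrite star_weight_contracted //.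
  have /eqP/cards2P[u [v [uv ->]]] := edges_card2 (subsetP CG _ eC).
  rewrite imsetU !imset_set1 !crosses_pair ?(inj_eq i_inj) // !inE.
  by case: (_ (+) _).
rewrite big_imset /=; last by move=> u v _ _; apply: spoke_inj.
transitivity (\sum_(v in mismatch S) inner_deg v).
  rewrite [RHS]big_mkcond /=; apply: eq_bigr => v _.
  by rewrite star_weight_spoke crosses_pair // inE.
rewrite /inner_deg; under eq_bigr => v _ do rewrite -sum1dep_card big_mkcondr.
rewrite exchange_big /=; apply: eq_bigr => e _.
rewrite -big_mkcondr -sum1_card; apply: eq_bigl => v.
by rewrite !inE andbC.
Qed.

Lemma cut_split T : cut G T =
  \sum_(e in C) crosses T e + \sum_(e in edges G :\: C) crosses T e.
Proof.
by rewrite cut_sum (big_setID C) /= (setIidPr CG).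
Qed.

(** Edge by edge: the endpoints of an inner edge share a hub, so if [S] separates them, exactly one
    is separated from that hub. *)
Lemma cut_star_ge (S : {set U}) : cut G (i @^-1: S) <= cut star_graph S.
Proof.
rewrite cut_split cut_star leq_add2l; apply: leq_sum => e eI.
have eG : e \in edges G by move: eI; rewrite inE => /andP[].
have /eqP/cards2P[u [v [uv Ee]]] := edges_card2 eG.
move: eI; rewrite Ee => /inner_x xuv.
rewrite crosses_pair // card_pairI // !inE xuv.
by do 3!case: (_ \in _).
Qed.

(** [F] decides the sides of the hubs. A non-terminal endpoint of an inner edge lies with its hub,
    so the other endpoint is mismatched exactly when the edge crosses [T]. *)
Lemma star_cut_exact s t (T F : {set V}) : s \in T -> t \notin T ->
  (forall v, v != s -> v != t -> (v \in F) = (v \in T)) ->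
  (forall u v, x u = x v -> (u \in F) = (v \in F)) ->
  let S := i @: T :|: x @: F in
  i @^-1: S = T /\ cut star_graph S = cut G T.
Proof.
move=> sT tT FT Fx S.
have iS v : (i v \in S) = (v \in T).
  rewrite !inE mem_imset // orbC; case: imsetP => // -[u _ /eqP].
  by rewrite (negPf (ix _ _)).
have xS v : (x v \in S) = (v \in F).
  rewrite !inE; case: imsetP => [[u _ /eqP]|_] /=.
    by rewrite eq_sym (negPf (ix _ _)).
  by apply/imsetP/idP => [[u uF /Fx->]|vF] //; exists v.
clearbody S; have ST : i @^-1: S = T by apply/setP=> v; rewrite inE iS.
split=> //; rewrite cut_split cut_star ST; congr (_ + _).
apply: eq_bigr => e eI.
have eG : e \in edges G by move: eI; rewrite inE => /andP[].
have /eqP/cards2P[u [v [uv Ee]]] := edges_card2 eG.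
move: eI; rewrite Ee => /inner_x/Fx Fuv.
rewrite crosses_pair // card_pairI // !inE !iS !xS.
have [/andP[us ut]|nu] := boolP ((u != s) && (u != t)).
  by rewrite -Fuv FT //; do 2!case: (_ \in T).
have [/andP[vs vt]|nv] := boolP ((v != s) && (v != t)).
  by rewrite Fuv FT //; do 2!case: (_ \in T).
(* Both endpoints are terminals: [T] separates them, and their common hub lies with exactly one of
   them. *)
have : (u \in T) (+) (v \in T).
  move: uv nu nv; rewrite !negb_and !negbK.
  move=> ab /orP[]/eqP Eu /orP[]/eqP Ev; move: ab; rewrite Eu Ev ?eqxx //.
    by rewrite sT (negPf tT).
  by rewrite sT (negPf tT).
by rewrite Fuv; do 2!case: (_ \in T); case: (_ \in F).
Qed.

(** Every cut of the hub graph is at least the cut that it induces on [G], and the cut built from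
    [T] and [F] attains the minimum of [G]. *)
Lemma star_apmc :
  (forall s t, s != t -> exists T F : {set V}, [/\ min_st_cut G s t T,
     forall v, v != s -> v != t -> (v \in F) = (v \in T)
     & forall u v, x u = x v -> (u \in F) = (v \in F)]) ->
  apmc_sparsifier i G star_graph.
Proof.
move=> h; split=> // s t st; have [T [F [[Tst Tc] FT Fx]]] := h s t st.
have [sT tT] := andP Tst.
have [/= ST cS] := star_cut_exact sT tT FT Fx.
set S := _ :|: _ in ST cS.
have Sst : st_cut (i s) (i t) S.
  by move: Tst; rewrite -ST /st_cut !inE.
have ist : i s != i t by rewrite (inj_eq i_inj).
have lamS : cut star_graph S = lambda star_graph (i s) (i t).
  apply/eqP; rewrite eqn_leq [X in _ && X]lambda_le // andbT.
  have [S0 [S0st <-]] := min_st_cut_exists star_graph ist.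
  apply: leq_trans (cut_star_ge S0).
  by rewrite cS Tc lambda_le //; move: S0st; rewrite /st_cut !inE.
by exists S; rewrite ST; split.
Qed.

End Star.

(* Registers: 0, output address; 1, the constant 1; 2, 3, 4, the sizes n, #|P|
   and m; 5, edge pointer; 7, output pointer; 8, degree address; 13, constantly
   0; 14, super-vertex address. The degrees are decremented in place. *)
Definition star_program : program := [::
  (* 0: output header *)
  IConst 1 1; ILoad 2 13; ILoad 3 1; IConst 11 2; ILoad 4 11; IConst 14 3;
  IAdd 8 14 2; IAdd 5 8 2; IAdd 0 5 4; IAdd 0 0 4;
  IAdd 11 2 3; IStore 0 11; IAdd 7 0 1; IAdd 11 4 2; IStore 7 11; IAdd 7 7 1;
  (* 16: edge loop test *)
  IJlt 5 0 18; IJlt 13 1 37;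
  (* 18: edge loop body *)
  ILoad 9 5; IStore 7 9; IAdd 7 7 1;
  IAdd 11 8 9; ILoad 12 11; ISub 12 12 1; IStore 11 12; IAdd 5 5 1;
  ILoad 9 5; IStore 7 9; IAdd 7 7 1;
  IAdd 11 8 9; ILoad 12 11; ISub 12 12 1; IStore 11 12; IAdd 5 5 1;
  IStore 7 1; IAdd 7 7 1; IJlt 13 1 16;
  (* 37: current vertex *)
  IConst 9 0;
  (* 38: spoke loop test *)
  IJlt 9 2 40; IHalt;
  (* 40: spoke loop body *)
  IStore 7 9; IAdd 7 7 1; ILoad 11 14; IAdd 11 11 2; IStore 7 11; IAdd 7 7 1;
  ILoad 11 8; IStore 7 11; IAdd 7 7 1;
  IAdd 14 14 1; IAdd 8 8 1; IAdd 9 9 1; IJlt 13 1 38].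

(** * Step-counted execution of word RAM programs *)

Section Execution.
Variables (w : nat) (prog : program).
Implicit Types (k p r a b : nat) (R M : nat -> nat) (Q : state -> Prop).

(** [k] is a budget: each instruction rule below spends one unit, and a remainder may be left
    over. *)
Definition runs k (st : state) Q : Prop :=
  exists2 t, t <= k & Q (iter t (step w prog) st).

Lemma runs_now k st Q : Q st -> runs k st Q.
Proof. by exists 0. Qed.

Lemma runs_leq k k' st Q : k <= k' -> runs k st Q -> runs k' st Q.
Proof. by move=> kk' [t tk Qt]; exists t => //; apply: leq_trans kk'. Qed.

Lemma runs_step k st Q : runs k (step w prog st) Q -> runs k.+1 st Q.
Proof. by move=> [t tk Qt]; exists t.+1 => //; rewrite iterSr. Qed.

(** Here and in the rule for addition, [x < 2 ^ w] excludes wrap-around. *)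
Lemma runs_const k p R M Q r x :
  nth IHalt prog p = IConst r x -> x < 2 ^ w ->
  runs k (State p.+1 (upd R r x) M) Q -> runs k.+1 (State p R M) Q.
Proof.
by move=> i xw h; apply: runs_step; rewrite /step /cur_instr /= i modn_small.
Qed.

Lemma runs_add k p R M Q r a b x :
  nth IHalt prog p = IAdd r a b -> R a + R b = x -> x < 2 ^ w ->
  runs k (State p.+1 (upd R r x) M) Q -> runs k.+1 (State p R M) Q.
Proof.
by move=> i <- xw h; apply: runs_step; rewrite /step /cur_instr /= i modn_small.
Qed.

Lemma runs_sub k p R M Q r a b x :
  nth IHalt prog p = ISub r a b -> R a - R b = x ->
  runs k (State p.+1 (upd R r x) M) Q -> runs k.+1 (State p R M) Q.
Proof.
by move=> i <- h; apply: runs_step; rewrite /step /cur_instr /= i.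
Qed.

Lemma runs_load k p R M Q r a y x :
  nth IHalt prog p = ILoad r a -> R a = y -> M y = x ->
  runs k (State p.+1 (upd R r x) M) Q -> runs k.+1 (State p R M) Q.
Proof.
by move=> i <- <- h; apply: runs_step; rewrite /step /cur_instr /= i.
Qed.

Lemma runs_store k p R M Q a b y x :
  nth IHalt prog p = IStore a b -> R a = y -> R b = x ->
  runs k (State p.+1 R (upd M y x)) Q -> runs k.+1 (State p R M) Q.
Proof.
by move=> i <- <- h; apply: runs_step; rewrite /step /cur_instr /= i.
Qed.

Lemma runs_jump k p R M Q a b l :
  nth IHalt prog p = IJlt a b l -> R a < R b ->
  runs k (State l R M) Q -> runs k.+1 (State p R M) Q.
Proof.
by move=> i lt h; apply: runs_step; rewrite /step /cur_instr /= i lt.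
Qed.

Lemma runs_skip k p R M Q a b l :
  nth IHalt prog p = IJlt a b l -> R b <= R a ->
  runs k (State p.+1 R M) Q -> runs k.+1 (State p R M) Q.
Proof.
by move=> i ge h; apply: runs_step; rewrite /step /cur_instr /= i ltnNge ge.
Qed.

End Execution.

(** * Sequences stored in memory *)

Definition holds (M : nat -> nat) (a : nat) (l : seq nat) : Prop :=
  forall j, j < size l -> M (a + j) = nth 0 l j.

Lemma holds_cat M a l1 l2 :
  holds M a l1 -> holds M (a + size l1) l2 -> holds M a (l1 ++ l2).
Proof.
move=> h1 h2 j; rewrite size_cat nth_cat => jl.
case: ltnP => [/h1//|lj]; rewrite -h2; last by lia.
by congr M; lia.
Qed.

Lemma holds_catl M a l1 l2 : holds M a (l1 ++ l2) -> holds M a l1.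
Proof.
move=> h j jl; rewrite h ?size_cat ?nth_cat ?jl //; lia.
Qed.

Lemma holds_catr M a l1 l2 : holds M a (l1 ++ l2) -> holds M (a + size l1) l2.
Proof.
move=> h j jl; rewrite -addnA h ?size_cat ?nth_cat ?ltn_add2l //.
by rewrite ltnNge leq_addr addKn.
Qed.

Lemma holds_upd M a l y x : holds M a l -> y < a \/ a + size l <= y ->
  holds (upd M y x) a l.
Proof. by move=> h out j jl; rewrite /upd ifF ?h //; apply/eqP; lia. Qed.

Lemma holds_rcons M a l y x : y = a + size l -> holds M a l ->
  holds (upd M y x) a (rcons l x).
Proof.
move=> -> h; rewrite -cats1; apply: holds_cat.
  by apply: holds_upd => //; lia.
by case=> // _; rewrite addn0 /upd eqxx.
Qed.

Definition endpoints (el : seq (nat * nat)) : seq nat :=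
  flatten [seq [:: e.1; e.2] | e <- el].

Definition unit_triples (el : seq (nat * nat)) : seq nat :=
  flatten [seq [:: e.1; e.2; 1] | e <- el].

Lemma endpoints_cat l1 l2 : endpoints (l1 ++ l2) = endpoints l1 ++ endpoints l2.
Proof. by rewrite /endpoints map_cat flatten_cat. Qed.

Lemma unit_triples_cat l1 l2 :
  unit_triples (l1 ++ l2) = unit_triples l1 ++ unit_triples l2.
Proof. by rewrite /unit_triples map_cat flatten_cat. Qed.

Lemma size_endpoints l : size (endpoints l) = 2 * size l.
Proof. by elim: l => // e l IH; rewrite /= IH; lia. Qed.

Lemma size_unit_triples l : size (unit_triples l) = 3 * size l.
Proof. by elim: l => // e l IH; rewrite /= IH; lia. Qed.

(** * Correctness and running time of the program *)

Section Correctness.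
Variables (w n p : nat) (sv dg : seq nat) (el : seq (nat * nat)).
Hypotheses (size_sv : size sv = n) (size_dg : size dg = n) (pn : p <= n).
Hypothesis el_lt : all (fun e => (e.1 < n) && (e.2 < n)) el.
Hypothesis sv_lt : forall v, v < n -> nth 0 sv v < n.
(** No constant or sum formed by the program exceeds [5 * (size el + n + 1)], the final output
    pointer, so none wraps around. *)
Hypothesis word : 10 * (size el + n + 1) <= 2 ^ w.

Local Notation m := (size el).
(** Memory layout: super-vertices from 3, degrees from [3 + n], edges from [eb], and the output from
    [ob], right behind the input. *)
Local Notation eb := (3 + n + n).
Local Notation ob := (eb + m + m).
Local Notation runs := (runs w star_program).

(** The hub with number [k] is vertex [k + n]. In the application the count is the number of
    contracted edges at [v], so the difference is the inner degree. *)
Definition spoke_triple v :=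
  [:: v; nth 0 sv v + n; nth 0 dg v - count_mem v (endpoints el)].

Definition spoke_triples vs := flatten [seq spoke_triple v | v <- vs].

Lemma size_spoke_triples vs : size (spoke_triples vs) = 3 * size vs.
Proof. by elim: vs => // v l IH; rewrite /= IH; lia. Qed.

Definition star_output :=
  [:: n + p; m + n] ++ unit_triples el ++ spoke_triples (iota 0 n).

Definition final (st : state) :=
  halted star_program st /\ outputs st star_output.

Ltac regs := rewrite /upd /=.
Ltac bound := apply: leq_trans word; lia.
Ltac exec_const := eapply runs_const; [reflexivity | bound | ].
Ltac exec_add H := eapply runs_add;
  [reflexivity | regs; rewrite ?H; reflexivity | bound | ].
Ltac exec_sub H := eapply runs_sub;
  [reflexivity | regs; rewrite ?H; reflexivity | ].
Ltac exec_store H := eapply runs_store;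
  [reflexivity | regs; rewrite ?H; reflexivity
  | regs; rewrite ?H; reflexivity | ].
Ltac exec_load H := eapply runs_load;
  [reflexivity | regs; rewrite ?H; reflexivity | | ].

(** Invariant at the spoke loop test, with the spokes of the vertices below [v] written and all
    degrees already lowered. *)
Definition inv2 v R M :=
  [/\ [/\ R 0 = ob, R 1 = 1, R 2 = n & R 7 = ob + 2 + 3 * m + 3 * v],
      [/\ R 8 = 3 + n + v, R 9 = v, R 13 = 0 & R 14 = 3 + v],
      holds M 3 sv,
      (forall u, u < n ->
         M (3 + n + u) = nth 0 dg u - count_mem u (endpoints el))
    & holds M ob ([:: n + p; m + n] ++ unit_triples el
                  ++ spoke_triples (iota 0 v))].

(** 14 steps per spoke, and one for the failing test, after which [IHalt] is reached. *)
Lemma loop2 d v R M : d + v = n -> inv2 v R M ->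
  runs (14 * d).+1 (State 38 R M) final.
Proof.
elim: d v R M => [|d IH] v R M dv.
  move=> [[R0 R1 R2 R7] [R8 R9 R13 R14] hsv hdg ho].
  apply: runs_skip; [reflexivity | by rewrite R2 R9; lia |].
  (* [outputs] unfolds to [holds] at the address in register 0. *)
  apply: runs_now; split=> //; rewrite /outputs /= R0 => j jl.
  by move: ho j jl; have -> : v = n by lia.
move=> [[R0 R1 R2 R7] [R8 R9 R13 R14] hsv hdg ho].
have vn : v < n by lia.
have Rs := (R0, R1, R2, R7, R8, R9, R13, R14).
have -> : (14 * d.+1).+1 = (14 * d).+1 + 14 by lia.
rewrite !addnS addn0.
apply: runs_jump; [reflexivity | by rewrite R2 R9 |].
exec_store Rs.
exec_add Rs.
exec_load Rs.
  rewrite /upd ifF; last by apply/eqP; lia.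
  by apply: hsv; rewrite size_sv.
have svv := sv_lt vn.
exec_add Rs.
exec_store Rs.
exec_add Rs.
exec_load Rs.
  rewrite /upd !ifF; try by apply/eqP; lia.
  exact: hdg.
exec_store Rs.
exec_add Rs.
exec_add Rs.
exec_add Rs.
exec_add Rs.
apply: runs_jump; [reflexivity | by regs; rewrite R1 R13 |].
apply: (IH v.+1); first by lia.
split; first by split; regs; rewrite ?Rs //; lia.
- by split; regs; rewrite ?Rs //; lia.
- by do 3!(apply: holds_upd; last by rewrite size_sv; lia).
- by move=> u un; rewrite /upd !ifF ?hdg //; apply/eqP; lia.
have -> : iota 0 v.+1 = iota 0 v ++ [:: v] by rewrite -addn1 iotaD.
rewrite /spoke_triples map_cat flatten_cat [flatten [seq _ | _ <- [:: v]]]/=.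
rewrite /spoke_triple !catA -!cat_rcons cats0.
have sz := size_spoke_triples (iota 0 v); rewrite size_iota in sz.
have sz1 := size_unit_triples el.
do 3!(apply: holds_rcons;
  first by rewrite ?size_rcons /= ?size_cat sz sz1; lia).
by rewrite -catA.
Qed.

(** Invariant at the edge loop test, with [l1] processed and [l2] ahead. *)
Definition inv1 (l1 l2 : seq (nat * nat)) R M :=
  [/\ [/\ R 0 = ob, R 1 = 1, R 2 = n & R 5 = eb + 2 * size l1],
      [/\ R 7 = ob + 2 + 3 * size l1, R 8 = 3 + n, R 13 = 0 & R 14 = 3],
      holds M 3 sv /\ holds M (eb + 2 * size l1) (endpoints l2),
      (forall u, u < n ->
         M (3 + n + u) = nth 0 dg u - count_mem u (endpoints l1))
    & holds M ob ([:: n + p; m + n] ++ unit_triples l1)].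

(** 20 steps per edge. The 4 others are the failing test, the jump, the initialization of register 9
    and the last test of the spoke loop. *)
Lemma loop1 l2 l1 R M : l1 ++ l2 = el -> inv1 l1 l2 R M ->
  runs (20 * size l2 + 14 * n + 4) (State 16 R M) final.
Proof.
elim: l2 l1 R M => [|[u v] l2 IH] l1 R M El.
  rewrite cats0 in El; rewrite El.
  move=> [[R0 R1 R2 R5] [R7 R8 R13 R14] [hsv _] hdg ho].
  have -> : 20 * 0 + 14 * n + 4 = (14 * n).+1 + 3 by lia.
  rewrite !addnS addn0.
  apply: runs_skip; [reflexivity | by rewrite R0 R5; lia |].
  apply: runs_jump; [reflexivity | by rewrite R1 R13 |].
  exec_const.
  apply: (@loop2 _ 0); first by rewrite addn0.
  split=> //; first by split; regs; rewrite ?R0 ?R1 ?R2 ?R7 //; lia.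
  - by split; regs; rewrite ?R8 ?R13 ?R14 //; lia.
  by rewrite cats0.
move=> [[R0 R1 R2 R5] [R7 R8 R13 R14] [hsv hel] hdg ho].
have Rs := (R0, R1, R2, R5, R7, R8, R13, R14).
have sz : size l1 + (size l2).+1 = m by rewrite -El size_cat.
have /andP[/= un vn] : (u < n) && (v < n).
  by apply: (allP el_lt (u, v)); rewrite -El mem_cat inE eqxx orbT.
rewrite /= in hel.
have -> : 20 * (size l2).+1 + 14 * n + 4 =
    (20 * size l2 + 14 * n + 4) + 20 by lia.
rewrite !addnS addn0.
apply: runs_jump; [reflexivity | by rewrite R0 R5; lia |].
exec_load Rs.
  by have := hel 0 isT; rewrite addn0 => ->.
exec_store Rs.
exec_add Rs.
exec_add Rs.
exec_load Rs.
  rewrite /upd ifF; last by apply/eqP; lia.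
  exact: hdg.
exec_sub Rs.
exec_store Rs.
exec_add Rs.
exec_load Rs.
  rewrite /upd !ifF; try by apply/eqP; lia.
  exact: (hel 1).
exec_store Rs.
exec_add Rs.
exec_add Rs.
(* The degree of [u] has just been lowered, which affects the word read here if [u = v]; distinct
   endpoints are not assumed at this level. *)
eapply (@runs_load _ _ _ _ _ _ _ _ _ _
  (nth 0 dg v - count_mem v (endpoints l1) - (u == v)));
  [reflexivity | regs; rewrite ?Rs; reflexivity | |].
  rewrite /upd ifF; last by apply/eqP; lia.
  rewrite eqn_add2l eq_sym; case: (u =P v) => [->|_]; first by [].
  rewrite ifF; last by apply/eqP; lia.
  by rewrite hdg // subn0.
exec_sub Rs.
exec_store Rs.
exec_add Rs.
exec_store Rs.
exec_add Rs.
apply: runs_jump; [reflexivity | by regs; rewrite R1 R13 |].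
apply: (@runs_leq _ _ (20 * size l2 + 14 * n + 4)); first by lia.
apply: (IH (rcons l1 (u, v))); first by rewrite cat_rcons.
split.
- by split; regs; rewrite ?Rs ?size_rcons //; lia.
- by split; regs; rewrite ?Rs ?size_rcons //; lia.
- split; first by do 5!(apply: holds_upd; last by rewrite size_sv; lia).
  have sz2 := size_endpoints l2.
  do 5!(apply: holds_upd; last by rewrite sz2 size_rcons; lia).
  move=> j jl; have := hel j.+2; rewrite /= => <- //.
  by congr M; rewrite size_rcons; lia.
- move=> x xn; rewrite -cats1 endpoints_cat count_cat /=.
  rewrite /upd ifF; last by apply/eqP; lia.
  rewrite !eqn_add2l; case: (x =P v) => [->|xv].
    by rewrite eqxx /=; case: (u == v); lia.
  rewrite ifF; last by apply/eqP; lia.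
  have -> : (v == x) = false by apply/eqP=> /esym.
  case: (x =P u) => [->|xu].
    by rewrite eqxx !addn0 subnDA.
  rewrite ifF; last by apply/eqP; lia.
  have -> : (u == x) = false by apply/eqP=> /esym.
  by rewrite hdg // !addn0.
have sz1 := size_unit_triples l1.
rewrite -cats1 unit_triples_cat catA [unit_triples [:: _]]/=.
rewrite -!cat_rcons cats0.
(* The stores are peeled off from the last to the first: three append to the output, and the two to
   the degrees lie below [ob]. *)
apply: holds_rcons; first by rewrite !size_rcons /= sz1; lia.
apply: holds_upd; last by lia.
apply: holds_rcons; first by rewrite !size_rcons /= sz1; lia.
apply: holds_upd; last by lia.
by apply: holds_rcons => //; rewrite /= sz1; lia.
Qed.

Lemma star_program_correct :
  exists2 st, halts_within w star_program
      ([:: n; p; m] ++ sv ++ dg ++ endpoints el) (40 * (m + n + 1)) st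
    & outputs st star_output.
Proof.
set x := _ ++ sv ++ _.
have hx : holds (nth 0 x) 0 x by [].
have hx3 := holds_catr hx; rewrite add0n [size _]/= in hx3.
have hsv := holds_catl hx3.
have hx4 := holds_catr hx3; rewrite size_sv in hx4.
have hdg := holds_catl hx4.
have hel := holds_catr hx4; rewrite size_dg in hel.
suff [t tk [h o]] : runs (40 * (m + n + 1)) (init_state x) final.
  by exists (iter t (step w star_program) (init_state x)) => //; exists t.
rewrite /init_state.
(* The header of 16 instructions precedes the edge loop. *)
apply: (@runs_leq _ _ (20 * m + 14 * n + 4 + 16)); first by lia.
rewrite [_ + 16]addnC; set k := 20 * m + 14 * n + 4.
rewrite [16 + k]/=.
(* The initial registers are concrete and evaluate by computation, so the execution tactics get a
   trivial equation. *)
have Rs := erefl 0.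
exec_const.
exec_load Rs; first by [].
exec_load Rs; first by [].
exec_const.
exec_load Rs; first by [].
exec_const.
exec_add Rs.
exec_add Rs.
exec_add Rs.
exec_add Rs.
exec_add Rs.
exec_store Rs.
exec_add Rs.
exec_add Rs.
exec_store Rs.
exec_add Rs.
apply: (@loop1 el [::]) => //.
split.
- by split; regs; rewrite ?muln0 ?addn0.
- by split; regs; rewrite ?muln0 ?addn0 //; lia.
- split; first by do 2!(apply: holds_upd; last by rewrite size_sv; lia).
  rewrite muln0 addn0.
  by do 2!(apply: holds_upd; last by rewrite size_endpoints; lia).
- move=> u un; rewrite subn0 /upd !ifF; try by apply/eqP; lia.
  by apply: hdg; rewrite size_dg.
case=> [|[|j]] //= _; rewrite /upd.
  by rewrite addn0 eqxx ifF //; apply/eqP; lia.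
by rewrite eqxx.
Qed.

End Correctness.

(** * The hub graph of the given contraction *)

Lemma nth_map_enum_ord n (f : 'I_n -> nat) (v : 'I_n) :
  nth 0 [seq f u | u <- enum 'I_n] v = f v.
Proof. by rewrite (@nth_map _ v _ 0 f) ?size_enum_ord // nth_ord_enum. Qed.

Section Sparsifier.
Variables (n : nat) (G : sgraph 'I_n) (P : {set {set 'I_n}}).
Variables (num : {set 'I_n} -> nat) (es : seq ('I_n * 'I_n)).
Hypothesis Ppart : partition P [set: 'I_n].
Hypothesis Pnum : supervertex_numbering P num.
Hypothesis es_list : edge_list (contraction_edges G P) es.

Local Notation C := (contraction_edges G P).
Local Notation i := (widen_ord (leq_addr #|P| n)).

Lemma pblock_in v : pblock P v \in P.
Proof. by rewrite pblock_mem // (cover_partition Ppart) inE. Qed.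

Lemma mem_own_pblock v : v \in pblock P v.
Proof. by rewrite mem_pblock (cover_partition Ppart) inE. Qed.

Lemma card_parts : #|P| <= n.
Proof.
rewrite -[X in _ <= X]card_ord -cardsT (card_partition Ppart) -sum1_card.
apply: leq_sum => B BP; rewrite card_gt0; apply: contraTneq BP => ->.
by have /and3P[] := Ppart.
Qed.

Lemma num_lt v : num (pblock P v) < #|P|.
Proof. by apply: Pnum.2; apply: pblock_in. Qed.

(** Hubs are numbered after the [n] vertices of [G], in agreement with the entry [nth 0 sv v + n] of
    [spoke_triple]. *)
Definition hub v : 'I_(n + #|P|) := rshift n (Ordinal (num_lt v)).

Lemma hub_eq u v : hub u = hub v -> pblock P u = pblock P v.
Proof.
move=> /(congr1 val) /= /addnI h.
by apply: Pnum.1; rewrite ?pblock_in.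
Qed.

Lemma hub_inner u v : [set u; v] \in edges G :\: C -> hub u = hub v.
Proof.
rewrite !inE => /andP[+ uvG]; rewrite uvG negbK.
case/existsP=> B /andP[BP /subsetP sB].
have tiP := partition_trivIset Ppart.
have bl a : a \in [set u; v] -> pblock P a = B.
  by move=> /sB aB; apply: def_pblock.
by apply: val_inj; rewrite /= !bl ?inE ?eqxx ?orbT.
Qed.

Lemma widen_hub u v : i u != hub v.
Proof. by rewrite -val_eqE /= neq_ltn (leq_trans (ltn_ord u)) ?leq_addr. Qed.

Lemma contraction_edges_sub : C \subset edges G.
Proof. by apply/subsetP=> e; rewrite inE => /andP[]. Qed.

Lemma widen_inj : injective i.
Proof. by move=> u v /(congr1 val) /= /val_inj. Qed.

Definition hub_graph : wgraph 'I_(n + #|P|) :=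
  star_graph contraction_edges_sub widen_inj widen_hub.

(** [F] is friendly of value at most [2 * n], so each part lies on one side of it, and membership in
    [F] depends on the hub only, as [star_apmc] requires. *)
Lemma hub_graph_apmc :
  (forall v, deg G v <> 1) -> friendly_cut_sparsifier (1 / 6)%R (2 * n) G P ->
  apmc_sparsifier i G hub_graph.
Proof.
move=> d1 [_ hfr]; apply: star_apmc; first exact: hub_inner.
move=> s t st; have [T [F [Tmin Ffr Fcut FT]]] := min_cut_near_friendly st d1.
rewrite card_ord in Fcut.
exists T, F; split=> // u v /hub_eq Euv.
have uB := mem_own_pblock u; have vB := mem_own_pblock v.
rewrite Euv in uB.
have /orP[/subsetP sub|dis] := hfr F Ffr Fcut _ (pblock_in v).
  by rewrite !sub.
by rewrite !(disjointFr dis).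
Qed.

Local Notation el := [seq (nat_of_ord e.1, nat_of_ord e.2) | e <- es].

Lemma mem_edge_list e : e \in es -> [set e.1; e.2] \in C.
Proof. by move=> ees; rewrite -mem_enum -(perm_mem es_list); apply: map_f. Qed.

Lemma size_edge_list : size es = #|C|.
Proof. by rewrite cardE -(perm_size es_list) size_map. Qed.

(** A contracted edge has distinct endpoints, so it contributes at most one occurrence of [v]. *)
Lemma count_endpoints (v : 'I_n) :
  count_mem (nat_of_ord v) (endpoints el) = \sum_(e in C) (v \in e).
Proof.
transitivity (\sum_(e <- es) (v \in [set e.1; e.2])).
  (* The induction runs over a sublist of the fixed [es], so that every entry is known to be a
     contracted edge. *)
  have : {subset es <= es} by [].
  elim: {1 3 4}es => [|e l IH] sub; first by rewrite big_nil.
  rewrite /= big_cons IH; last by move=> f fl; apply: sub; rewrite inE fl orbT.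
  have : [set e.1; e.2] \in C by rewrite mem_edge_list // sub // mem_head.
  move/(subsetP contraction_edges_sub)/edges_card2; rewrite cards2.
  case: eqP => // e12 _; rewrite !inE !val_eqE ![v == _]eq_sym addnA.
  congr (_ + _); case: (e.1 =P v) e12 => [->|]; case: (e.2 =P v) => [->|] //.
by rewrite -(big_map (fun e => [set e.1; e.2]) predT (fun f => v \in f : nat))
  (perm_big _ es_list) big_enum.
Qed.

(** Links the two halves of the proof: what the program writes encodes the graph whose cuts were
    analysed. *)
Lemma hub_graph_code :
  wgraph_code hub_graph ([seq (i e.1, i e.2) | e <- es]
                         ++ [seq (i v, hub v) | v <- enum 'I_n])
  = star_output n #|P| [seq num (pblock P v) | v <- enum 'I_n]
      [seq deg G v | v <- enum 'I_n] el.
Proof.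
rewrite /wgraph_code /star_output size_cat !(size_map _ es).
rewrite (size_map _ (enum 'I_n)) size_enum_ord.
congr (_ ++ _); rewrite map_cat flatten_cat; congr (_ ++ _).
  rewrite /unit_triples -2!map_comp; congr flatten; apply/eq_in_map=> e ees /=.
  have -> : [set i e.1; i e.2] = i @: [set e.1; e.2].
    by rewrite imsetU !imset_set1.
  by rewrite star_weight_contracted ?mem_edge_list.
rewrite /spoke_triples -[in RHS]val_enum_ord -2!map_comp; congr flatten.
apply: eq_map => v; rewrite /spoke_triple /= !nth_map_enum_ord.
rewrite star_weight_spoke; last first.
- exact: widen_hub.
- exact: widen_inj.
by rewrite inner_degE ?contraction_edges_sub // count_endpoints addnC.
Qed.

End Sparsifier.

Theorem theorem2p3 :
  exists (prog : program) (c K : nat),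
  forall (n : nat) (G : sgraph 'I_n) (P : {set {set 'I_n}}),
    (forall v : 'I_n, deg G v <> 1) ->
    friendly_cut_sparsifier (1 / 6)%R (2 * n) G P ->
  forall (num : {set 'I_n} -> nat) (es : seq ('I_n * 'I_n)),
    supervertex_numbering P num ->
    edge_list (contraction_edges G P) es ->
  forall w : nat, K * (#|contraction_edges G P| + n + 1) <= 2 ^ w ->
  exists (st : state) (N : nat) (le_nN : n <= N) (H : wgraph 'I_N),
    [/\ halts_within w prog (input_code G P num es)
          (c * (#|contraction_edges G P| + n + 1)) st,
        outputs_wgraph st H,
        apmc_sparsifier (widen_ord le_nN) G H
      & #|wedges H| <= #|contraction_edges G P| + n].
Proof.
(* With [m] contracted edges, [40] covers the [20 * m + 14 * n + 20] steps, and [10] makes all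
   addresses and sums fit into a word. *)
exists star_program, 40, 10 => n G P d1 fr num es Pnum es_list w word.
have Ppart := fr.1; have szC := size_edge_list es_list.
pose el := [seq (nat_of_ord e.1, nat_of_ord e.2) | e <- es].
have szel : size el = #|contraction_edges G P| by rewrite size_map.
have [st hst ost] : exists2 st, halts_within w star_program
    (input_code G P num es) (40 * (#|contraction_edges G P| + n + 1)) st
    & outputs st (star_output n #|P| [seq num (pblock P v) | v <- enum 'I_n]
                    [seq deg G v | v <- enum 'I_n] el).
  have -> : input_code G P num es = [:: n; #|P|; size el]
      ++ [seq num (pblock P v) | v <- enum 'I_n]
      ++ [seq deg G v | v <- enum 'I_n] ++ endpoints el.
    by rewrite /input_code szel -szC /endpoints -(map_comp _ _ es).
  rewrite -szel; apply: star_program_correct.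
  - by rewrite size_map size_enum_ord.
  - by rewrite size_map size_enum_ord.
  - exact: card_parts.
  - by rewrite all_map; apply/allP=> e _ /=; rewrite !ltn_ord.
  - move=> v vn; rewrite (nth_map_enum_ord _ (Ordinal vn)).
    exact: leq_trans (num_lt Ppart Pnum _) (card_parts Ppart).
  by rewrite szel.
exists st, (n + #|P|), (leq_addr #|P| n), (hub_graph G Ppart Pnum); split=> //.
- exists ([seq (widen_ord (leq_addr #|P| n) e.1,
                widen_ord (leq_addr #|P| n) e.2) | e <- es]
          ++ [seq (widen_ord (leq_addr #|P| n) v, hub Ppart Pnum v)
             | v <- enum 'I_n]).
    apply: star_edge_list => //; [exact: widen_inj | exact: widen_hub].
  by rewrite hub_graph_code.
- exact: hub_graph_apmc.
by rewrite -[X in _ <= _ + X]card_ord; apply: card_star_edges.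
Qed.
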